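(* Consider $n$ homogeneous hard balls moving freely and colliding elastically in $\mathbb{R}^3$: every ball moves along a straight line with constant speed until two balls collide, and then the new velocities of the two balls are determined by the laws of classical mechanics. Assume that only two balls can collide at the same time. Then the total number of collisions cannot exceed some number $N$ that depends only on the radii and masses of the balls (in particular, not on the initial positions and velocities). If the balls are identical, then $N$ depends only on $n$.
   Context: The $i$-th ball has radius $R_i>0$, mass $M_i>0$ and center $a_i(t)\in\mathbb{R}^3$; admissible configurations satisfy $|a_i-a_j|\ge R_i+R_j$ for all $i\ne j$, and balls $i$ and $j$ collide when $|a_i-a_j|=R_i+R_j$ and they are approaching each other. At a collision of balls $i$ and $j$ the velocity components orthogonal to $a_i-a_j$ are unchanged, while the components along $a_i-a_j$ change as in a one-dimensional elastic collision of masses $M_i$ and $M_j$ (total momentum and kinetic energy are preserved and the relative velocity along $a_i-a_j$ changes sign). *)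

(* Defs.v *)
From mathcomp Require Import all_boot all_order all_algebra.
From mathcomp Require Import all_classical all_reals.

Set Implicit Arguments.
Unset Strict Implicit.
Unset Printing Implicit Defensive.

Import Order.TTheory GRing.Theory Num.Theory.
Local Open Scope classical_set_scope.
Local Open Scope ring_scope.

Section HardBalls.
Variables (R : realType) (n : nat).

Notation vec := 'rV[R]_3.

Definition dot (u v : vec) : R := \sum_k u ord0 k * v ord0 k.

(* The norm that MathComp-Analysis puts on matrices is the sup norm. *)
Definition enorm (u : vec) : R := Num.sqrt (dot u u).

Definition proj_along (w u : vec) : vec := (dot u w / dot w w) *: w.
Definition proj_orth (w u : vec) : vec := u - proj_along w u.

(* [u1], [u2] are the velocities of the balls of masses [m1], [m2] before the
   collision and [u1'], [u2'] those after it; [w] joins the two centers. *)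
Record elastic_collision (m1 m2 : R) (w u1 u2 u1' u2' : vec) : Prop := {
  elastic_orth1 : proj_orth w u1' = proj_orth w u1;
  elastic_orth2 : proj_orth w u2' = proj_orth w u2;
  elastic_momentum : m1 *: u1' + m2 *: u2' = m1 *: u1 + m2 *: u2;
  elastic_energy :
    m1 / 2 * enorm u1' ^+ 2 + m2 / 2 * enorm u2' ^+ 2 =
    m1 / 2 * enorm u1 ^+ 2 + m2 / 2 * enorm u2 ^+ 2;
  elastic_reflect : dot (u1' - u2') w = - dot (u1 - u2) w
}.

(* [vel_in] and [vel_out] are the velocities just before and just after a given
   time; they can only differ at a collision. At a first instant of the motion
   [vel_in] is the prescribed initial velocity. *)
Record motion := Motion {
  pos : 'I_n -> R -> vec;
  vel_in : 'I_n -> R -> vec;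
  vel_out : 'I_n -> R -> vec
}.

Variables (rad mass : 'I_n -> R).

Definition colliding (a : motion) (t : R) (i j : 'I_n) : Prop :=
  [/\ i != j,
      enorm (pos a i t - pos a j t) = rad i + rad j &
      dot (pos a i t - pos a j t) (vel_in a i t - vel_in a j t) < 0].

(* The time domain [I] is an arbitrary interval. Each motion has locally
   finitely many collision times in [I], but they may still accumulate at an
   end of [I] that does not belong to [I]. *)
Record hard_ball_motion (I : interval R) (a : motion) : Prop := {
  admissible : forall t, t \in I -> forall i j, i != j ->
    rad i + rad j <= enorm (pos a i t - pos a j t);
  straight_motion : forall t, t \in I -> forall i, exists2 e : R, 0 < e &
    forall s, s \in I ->
      (t - e < s <= t -> pos a i s = pos a i t + (s - t) *: vel_in a i t) /\
      (t <= s < t + e -> pos a i s = pos a i t + (s - t) *: vel_out a i t);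
  free_flight : forall t, t \in I -> forall i,
    (forall j, ~ colliding a t i j) -> vel_out a i t = vel_in a i t;
  collision_law : forall t, t \in I -> forall i j, colliding a t i j ->
    elastic_collision (mass i) (mass j) (pos a i t - pos a j t)
      (vel_in a i t) (vel_in a j t) (vel_out a i t) (vel_out a j t)
}.

(* Each colliding pair is listed once, with its smaller index first. *)
Definition collisions (I : interval R) (a : motion) : set (R * 'I_n * 'I_n) :=
  [set c : R * 'I_n * 'I_n | [/\ c.1.1 \in I, (c.1.2 < c.2)%N &
                             colliding a c.1.1 c.1.2 c.2]].

Definition only_two_balls_collide (I : interval R) (a : motion) : Prop :=
  forall t i j k l, collisions I a (t, i, j) -> collisions I a (t, k, l) ->
    (i, j) = (k, l).

End HardBalls.

(* Main.v *)
(* A configuration of the balls is a point of R^(3n), with the inner product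
   weighted by the masses. The pairs of overlapping balls are convex walls, and
   the motion is a billiard path of constant speed w among these walls. If q lies
   in all the walls hit during [s, t], then <x - q, v> - w^2 t is nondecreasing,
   because a reflection pushes the velocity away from q; hence the length of the
   path is at most |x(s) - q| + |q - x(t)|.

   Argue by induction on the number of walls: a block of sufficiently many hits
   must involve every wall. Over two consecutive such blocks the path hits every
   wall both before and after their common time. Its deviation from its chord is
   controlled by its excess e (its length minus that of the chord), and the walls
   are convex, so all of them pass near the point of the chord at that time. The
   walls are nondegenerate, so their intersection does too, and a detour from one
   end to the other through it costs at most C e more than the chord. Compare a whole
   path of kappa double blocks of excesses e_j > 0 with the polygon of its chords
   detoured at j: the sum of the e_i is at most C e_j for every j, so kappa <= C.
   The constant C depends only on n and on the ratios of masses and of radii. *)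
Require Import Defs.
From mathcomp Require Import all_boot all_order all_algebra.
From mathcomp Require Import all_classical all_reals.
From mathcomp Require Import ring lra zify.

Set Implicit Arguments.
Unset Strict Implicit.
Unset Printing Implicit Defensive.

Import Order.TTheory GRing.Theory Num.Theory.
Local Open Scope classical_set_scope.
Local Open Scope ring_scope.
Local Open Scope card_scope.

(** * Semi-inner products *)

Record inner_product (R : realType) (V : lmodType R) (ip : V -> V -> R) : Prop :=
  InnerProduct {
    ipC : forall u v, ip u v = ip v u;
    ipDl : forall u v w, ip (u + v) w = ip u w + ip v w;
    ipZl : forall a u v, ip (a *: u) v = a * ip u v;
    ip_ge0 : forall u, 0 <= ip u u
  }.

Definition ipnorm (R : realType) (V : lmodType R) (ip : V -> V -> R) (u : V) : R :=
  Num.sqrt (ip u u).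

Section InnerProductTheory.
Variables (R : realType) (V : lmodType R) (ip : V -> V -> R).
Hypothesis ipP : inner_product ip.
Local Notation "`[ u ]" := (ipnorm ip u) (format "`[ u ]").

Lemma ipDr u v w : ip u (v + w) = ip u v + ip u w.
Proof. by rewrite ipC// ipDl// ![ip _ u]ipC. Qed.

Lemma ipZr a u v : ip u (a *: v) = a * ip u v.
Proof. by rewrite ipC// ipZl// [ip _ u]ipC. Qed.

Lemma ipNl u v : ip (- u) v = - ip u v.
Proof. by rewrite -scaleN1r ipZl// mulN1r. Qed.

Lemma ipNr u v : ip u (- v) = - ip u v.
Proof. by rewrite -scaleN1r ipZr// mulN1r. Qed.

Definition ipE := (ipDl ipP, ipDr, ipZl ipP, ipZr, ipNl, ipNr).

Lemma ipnorm_ge0 u : 0 <= `[u].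
Proof. exact: sqrtr_ge0. Qed.

Lemma sqr_ipnorm u : `[u] ^+ 2 = ip u u.
Proof. by rewrite sqr_sqrtr// ip_ge0. Qed.

Lemma ipnorm0 : `[0] = 0.
Proof. by rewrite /ipnorm -(scale0r 0) ipZl// mul0r sqrtr0. Qed.

Lemma ipnormN u : `[- u] = `[u].
Proof. by rewrite /ipnorm !ipE opprK. Qed.

Lemma ipnorm_sub_sym u v : `[u - v] = `[v - u].
Proof. by rewrite -ipnormN opprB. Qed.

Lemma ipnormZ a u : `[a *: u] = `|a| * `[u].
Proof. by rewrite /ipnorm !ipE mulrA -expr2 sqrtrM ?sqr_ge0// sqrtr_sqr. Qed.

Lemma cauchy_schwarz u v : ip u v <= `[u] * `[v].
Proof.
have u0 := ipnorm_ge0 u; have v0 := ipnorm_ge0 v.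
have [/eqP uv0|uv0] := eqVneq (`[u] * `[v]) 0; last first.
  have uv_gt0 : 0 < `[u] * `[v] by rewrite lt_neqAle eq_sym uv0 mulr_ge0.
  have := ip_ge0 ipP (`[v] *: u - `[u] *: v).
  rewrite !ipE -!sqr_ipnorm [ip v u]ipC// => h.
  rewrite -(ler_pM2l uv_gt0); nra.
(* A vector of norm 0 need not vanish. Were [ip a b] positive, subtracting a large multiple of [a]
   from [b] would give a vector of negative square. *)
have half a b : ip a a = 0 -> ip a b <= 0.
  move=> a0; rewrite leNgt; apply/negP => ab0.
  have := ip_ge0 ipP (b - ((ip b b + 1) / ip a b) *: a).
  rewrite !ipE a0 [ip b a]ipC// !mulr0 divfK ?gt_eqF//.
  by have := ip_ge0 ipP b; lra.
move: uv0; rewrite mulf_eq0 => /orP[]/eqP h; rewrite h ?mul0r ?mulr0.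
  by apply: half; rewrite -sqr_ipnorm h expr0n.
by rewrite ipC//; apply: half; rewrite -sqr_ipnorm h expr0n.
Qed.

Lemma ler_ipnormD u v : `[u + v] <= `[u] + `[v].
Proof.
rewrite -(@ler_pXn2r _ 2)// ?nnegrE ?addr_ge0 ?ipnorm_ge0//.
rewrite sqr_ipnorm !ipE -!sqr_ipnorm [ip v u]ipC//.
by have := cauchy_schwarz u v; nra.
Qed.

Lemma ler_ipnorm_dist w u v : `[u - v] <= `[u - w] + `[w - v].
Proof.
have -> : u - v = (u - w) + (w - v) by rewrite addrA subrK.
exact: ler_ipnormD.
Qed.

Lemma stewart a u v :
  ip ((1 - a) *: u + a *: v) ((1 - a) *: u + a *: v) =
  (1 - a) * ip u u + a * ip v v - a * (1 - a) * ip (v - u) (v - u).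
Proof. by rewrite !ipE [ip v u]ipC//; ring. Qed.

End InnerProductTheory.

(** * Chords of a path and detours from them *)

Section Chord.
Variables (R : realType) (V : lmodType R) (ip : V -> V -> R).
Hypothesis ipP : inner_product ip.
Local Notation "`[ u ]" := (ipnorm ip u) (format "`[ u ]").

Definition chord (x y : V) (a : R) : V := (1 - a) *: x + a *: y.

Lemma chordB x y x' y' a :
  chord x y a - chord x' y' a = (1 - a) *: (x - x') + a *: (y - y').
Proof. by rewrite /chord !scalerBr opprD addrACA. Qed.

Lemma chordxx x a : chord x x a = x.
Proof. by rewrite /chord -scalerDl subrK scale1r. Qed.

Lemma subr_chord z x y a : z - chord x y a = (1 - a) *: (z - x) + a *: (z - y).
Proof. by rewrite -{1}(chordxx z a) chordB. Qed.

(* Deviation from the chord of a path of length [L] from [x] to [y]; [b] is the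
   fraction of the length at which [z] lies on the path. *)
Lemma chord_deviation x y z (L b : R) : 0 <= b <= 1 ->
  `[z - x] <= b * L -> `[z - y] <= (1 - b) * L ->
  ip (z - chord x y b) (z - chord x y b) <=
  b * (1 - b) * (L ^+ 2 - ip (y - x) (y - x)).
Proof.
move=> /andP[b0 b1] zx zy; rewrite subr_chord stewart//.
have -> : z - y - (z - x) = - (y - x) by rewrite opprB addrC addrA subrK opprB.
rewrite !(ipNl ipP, ipNr ipP) opprK -!(sqr_ipnorm ipP) in zx zy *.
have hx : `[z - x] ^+ 2 <= (b * L) ^+ 2.
  by rewrite ler_sqr ?nnegrE ?ipnorm_ge0// (le_trans _ zx)// ipnorm_ge0.
have hy : `[z - y] ^+ 2 <= ((1 - b) * L) ^+ 2.
  by rewrite ler_sqr ?nnegrE ?ipnorm_ge0// (le_trans _ zy)// ipnorm_ge0.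
have := ler_wpM2l (x := 1 - b) _ hx; have := ler_wpM2l b0 hy.
rewrite subr_ge0 => k1 /(_ b1) k2; nra.
Qed.

Lemma mem_segment (b1 b2 a : R) : b1 <= a <= b2 ->
  exists2 c, 0 <= c <= 1 & a = (1 - c) * b1 + c * b2.
Proof.
move=> /andP[h1 h2]; have [b12|b12] := eqVneq b1 b2.
  by exists 0; [rewrite lexx ler01|lra].
have hb : 0 < b2 - b1 by rewrite subr_gt0 lt_neqAle b12 (le_trans h1).
exists ((a - b1) / (b2 - b1)).
  by rewrite divr_ge0 ?subr_ge0// ?(le_trans h1)//= ler_pdivrMr// mul1r lerB.
by field; rewrite gt_eqF.
Qed.

(** The factor [b * (1 - b)] is concave in [b], so by [stewart] the bound of [chord_deviation]
    passes from two points of a path to the points of the segment between them. *)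
Lemma chord_interpolation x y z1 z2 (Q b1 b2 c a : R) :
  0 <= c <= 1 -> 0 <= Q -> a = (1 - c) * b1 + c * b2 ->
  ip (z1 - chord x y b1) (z1 - chord x y b1) <= b1 * (1 - b1) * Q ->
  ip (z2 - chord x y b2) (z2 - chord x y b2) <= b2 * (1 - b2) * Q ->
  ip (chord z1 z2 c - chord x y a) (chord z1 z2 c - chord x y a) <=
  a * (1 - a) * Q.
Proof.
move=> /andP[c0 c1] Q0 ac h1 h2.
have -> : chord x y a = chord (chord x y b1) (chord x y b2) c.
  rewrite /chord !scalerDr !scalerA addrACA -!scalerDl ac.
  by congr (_ *: _ + _ *: _); ring.
rewrite chordB stewart//.
set D := ip (_ - _ - _) _; have D0 : 0 <= D by exact: ip_ge0.
have := ler_wpM2l c0 h2; have := @ler_wpM2l _ (1 - c) _ _ _ h1.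
rewrite subr_ge0 => /(_ c1) k1 k2.
have h : 0 <= c * (1 - c) * (b1 - b2) ^+ 2 * Q.
  by apply: mulr_ge0 => //; rewrite mulr_ge0 ?sqr_ge0 ?mulr_ge0 ?subr_ge0.
have h' : 0 <= c * (1 - c) * D by rewrite !mulr_ge0 ?subr_ge0.
rewrite ac; nra.
Qed.

(** By [stewart] and Cauchy-Schwarz, the squared length of the detour is at most that of the chord
    plus the squared distance from [q] to the chord point divided by [a * (1 - a)]. This cancels the
    same factor in the deviation bound, and [1 <= C] absorbs the rest. *)
Lemma chord_detour x y q (a C L : R) : 0 < a < 1 -> 1 <= C -> `[y - x] <= L ->
  ip (q - chord x y a) (q - chord x y a) <=
    C * (a * (1 - a) * (L ^+ 2 - ip (y - x) (y - x))) ->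
  `[x - q] + `[q - y] <= `[y - x] + C * (L - `[y - x]).
Proof.
move=> /andP[a0 a1] C1 lL; rewrite subr_chord stewart//.
have -> : q - y - (q - x) = - (y - x) by rewrite opprB addrC addrA subrK opprB.
rewrite !(ipNl ipP, ipNr ipP) opprK -!(sqr_ipnorm ipP) (ipnorm_sub_sym ipP x).
set u := `[q - x]; set v := `[q - y]; set l := `[y - x] in lL *.
have u0 : 0 <= u by exact: ipnorm_ge0.
have v0 : 0 <= v by exact: ipnorm_ge0.
have l0 : 0 <= l by exact: ipnorm_ge0.
move=> h.
have aa : 0 < a * (1 - a) by rewrite mulr_gt0// subr_gt0.
have s : (u + v) ^+ 2 <= l ^+ 2 + C * (L ^+ 2 - l ^+ 2).
  rewrite -(ler_pM2l aa); have := sqr_ge0 ((1 - a) * u - a * v); nra.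
rewrite -(@ler_pXn2r _ 2)// ?nnegrE ?addr_ge0//; last first.
  by rewrite mulr_ge0 ?subr_ge0// (le_trans ler01).
apply: (le_trans s).
have : 0 <= C * (C - 1) * (L - l) ^+ 2.
  by rewrite mulr_ge0 ?sqr_ge0// mulr_ge0 ?subr_ge0// (le_trans ler01).
nra.
Qed.

End Chord.

(** * Billiard paths among convex walls *)

Section SemiDispersing.
Variables (R : realType) (V : lmodType R) (ip : V -> V -> R).
Hypothesis ipP : inner_product ip.
Local Notation "`[ u ]" := (ipnorm ip u) (format "`[ u ]").
Variables (K : finType) (B : K -> set V).

Definition convex_walls := forall k y z c, 0 <= c <= 1 ->
  B k y -> B k z -> B k (chord y z c).

(* [C] bounds the square of the ratio of the distance to an intersection of
   walls and the largest distance to one of these walls. *)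
Definition nondegenerate_walls (C : R) := forall (S : {set K}) c d,
  0 <= d ->
  (forall k, k \in S -> exists2 y, B k y & ip (y - c) (y - c) <= d) ->
  exists2 q, (forall k, k \in S -> B k q) & ip (q - c) (q - c) <= C * d.

(* [hit t k]: the wall [B k] reflects the path at time [t]. *)
Record billiard_path (T : set R) (x : R -> V) (w : R) (hit : R -> K -> Prop) :
    Prop := {
  hit_wall : forall t k, T t -> hit t k -> B k (x t);
  path_lipschitz : forall s t, T s -> T t -> s <= t ->
    `[x t - x s] <= w * (t - s);
  path_bends : forall s t u k, T s -> T u -> s < t < u -> T t -> hit t k ->
    `[x u - x s] < w * (u - s);
  path_detour : forall s t q, T s -> T t -> s <= t ->
    (forall u k, s <= u <= t -> T u -> hit u k -> B k q) ->
    w * (t - s) <= `[x s - q] + `[q - x t]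
}.

Section Path.
Variables (C : R) (T : set R) (x : R -> V) (w : R) (hit : R -> K -> Prop).
Hypotheses (Bcvx : convex_walls) (BC : nondegenerate_walls C) (C1 : 1 <= C).
Hypothesis xP : billiard_path T x w hit.

Lemma exists_detour (S : {set K}) s t u : T s -> T t -> T u -> s < t < u ->
  (forall k, k \in S -> exists v, [/\ s <= v <= t, T v & hit v k]) ->
  (forall k, k \in S -> exists v, [/\ t <= v <= u, T v & hit v k]) ->
  exists2 q, (forall k, k \in S -> B k q) &
    `[x s - q] + `[q - x u] <=
    `[x u - x s] + C * (w * (u - s) - `[x u - x s]).
Proof.
move=> Ts Tt Tu /andP[st tu] hit1 hit2.
have su : 0 < u - s by rewrite subr_gt0 (lt_trans st).
pose f v := (v - s) / (u - s).
have f01 v : s <= v <= u -> 0 <= f v <= 1.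
  move=> /andP[sv vu]; rewrite ler_pdivrMr// mul1r lerB// andbT.
  by rewrite divr_ge0 ?(ltW su)// subr_ge0.
have fle v v' : v <= v' -> f v <= f v'.
  by move=> h; rewrite ler_pM2r ?invr_gt0// lerB.
pose L := w * (u - s).
have fL v : f v * L = w * (v - s) by rewrite /f /L; field; rewrite gt_eqF.
have f'L v : (1 - f v) * L = w * (u - v).
  by rewrite /f /L; field; rewrite gt_eqF.
have lL : `[x u - x s] <= L by apply: (path_lipschitz xP) => //; lra.
pose Q := L ^+ 2 - ip (x u - x s) (x u - x s).
have Q0 : 0 <= Q.
  rewrite subr_ge0 -(sqr_ipnorm ipP) ler_sqr ?nnegrE ?ipnorm_ge0//.
  exact: le_trans (ipnorm_ge0 _ _) lL.
have dev v : s <= v <= u -> T v ->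
    ip (x v - chord (x s) (x u) (f v)) (x v - chord (x s) (x u) (f v)) <=
    f v * (1 - f v) * Q.
  move=> svu Tv; apply: chord_deviation => //; first exact: f01.
    by rewrite fL; apply: (path_lipschitz xP) => //; case/andP: svu.
  rewrite f'L (ipnorm_sub_sym ipP); apply: (path_lipschitz xP) => //.
  by case/andP: svu.
have ft01 : 0 < f t < 1.
  by rewrite ltr_pdivrMr// mul1r ltrD2r tu andbT divr_gt0// subr_gt0.
have [|k kS|q qS qQ] := BC (S := S) (c := chord (x s) (x u) (f t))
    (d := f t * (1 - f t) * Q).
  by case/andP: ft01 => ft0 ft1; rewrite mulr_ge0// mulr_ge0 ?subr_ge0// ltW.
  have [v1 [/andP[sv1 v1t] Tv1 h1]] := hit1 _ kS.
  have [v2 [/andP[tv2 v2u] Tv2 h2]] := hit2 _ kS.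
  (* The wall [k] is hit on both sides of [t], so by convexity it contains the point of the segment
     between the two hits that corresponds to the fraction [f t]. *)
  have [|c c01 fc] := @mem_segment _ (f v1) (f v2) (f t); first by rewrite !fle.
  exists (chord (x v1) (x v2) c).
    by apply: Bcvx => //; apply: (hit_wall xP).
  by apply: chord_interpolation fc _ _ => //; apply: dev => //; lra.
exists q => //; exact: (chord_detour ipP ft01).
Qed.

Lemma polygon_length (y : nat -> V) i j : (i <= j)%N ->
  `[y i - y j] <= \sum_(i <= l < j) `[y l.+1 - y l].
Proof.
elim: j => [|j IHj].
  by rewrite leqn0 => /eqP->; rewrite big_geq// subrr (ipnorm0 ipP).
rewrite leq_eqVlt => /orP[/eqP->|].
  by rewrite big_geq// subrr (ipnorm0 ipP).
rewrite ltnS => ij; rewrite big_nat_recr//=.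
apply: (le_trans (ler_ipnorm_dist ipP (y j) _ _)).
by rewrite lerD ?IHj// (ipnorm_sub_sym ipP).
Qed.

(* Were there [kappa > C] double blocks, replacing the one of smallest excess
   by its detour would yield a path shorter than the billiard path. *)
Lemma few_double_blocks (S : {set K}) (kappa : nat) (y z : nat -> R) :
  (0 < kappa)%N ->
  (forall j, (j <= kappa)%N -> T (y j)) ->
  (forall j, (j < kappa)%N -> T (z j) /\ y j < z j < y j.+1) ->
  (forall j, (j < kappa)%N -> exists k, hit (z j) k) ->
  (forall j k, (j < kappa)%N -> k \in S ->
     (exists v, [/\ y j <= v <= z j, T v & hit v k]) /\
     (exists v, [/\ z j <= v <= y j.+1, T v & hit v k])) ->
  (forall u k, y 0%N <= u <= y kappa -> T u -> hit u k -> k \in S) ->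
  kappa%:R <= C.
Proof.
move=> kappa0 Ty Tz hitz hitS inS.
pose l j := `[x (y j.+1) - x (y j)].
pose e j := w * (y j.+1 - y j) - l j.
have e_gt0 j : (j < kappa)%N -> 0 < e j.
  move=> jk; have [k hk] := hitz j jk; have [Tzj yz] := Tz j jk.
  rewrite subr_gt0; apply: (path_bends xP) yz Tzj hk; apply: Ty => //.
  exact: ltnW.
have y_le j : (j <= kappa)%N -> y 0%N <= y j.
  elim: j => // j IHj jk; apply: (le_trans (IHj (ltnW jk))).
  by have [_] := Tz j jk; lra.
(* The point [q] lies in every wall hit, so the whole path is no longer than the chords of the other
   blocks plus the detour through [q] in block [j]. *)
have sum_e j : (j < kappa)%N -> \sum_(0 <= i < kappa) e i <= C * e j.
  move=> jk; have [Tzj yz] := Tz j jk.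
  have [//||||q qS qle] := @exists_detour S (y j) (z j) (y j.+1) _ Tzj _ yz.
  - by apply: Ty; exact: ltnW.
  - exact: Ty.
  - by move=> k kS; case: (hitS j k jk kS).
  - by move=> k kS; case: (hitS j k jk kS).
  have : w * (y kappa - y 0%N) <= `[x (y 0%N) - q] + `[q - x (y kappa)].
    apply: (path_detour xP); [exact: Ty|exact: Ty|exact: y_le|].
    by move=> u k yu Tu hu; apply: qS; apply: inS hu.
  have := ler_ipnorm_dist ipP (x (y j)) (x (y 0%N)) q.
  have := ler_ipnorm_dist ipP (x (y j.+1)) q (x (y kappa)).
  have := polygon_length (x \o y) (leq0n j).
  have := polygon_length (x \o y) jk.
  have -> : w * (y kappa - y 0%N) = \sum_(0 <= i < kappa) (e i + l i).
    rewrite (eq_bigr (fun i => w * (y i.+1 - y i))); last first.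
      by move=> i _; rewrite /e subrK.
    by rewrite -mulr_sumr telescope_sumr.
  rewrite big_split/= (@big_cat_nat _ _ _ j.+1 0%N kappa _ l)//=.
  rewrite (big_nat_recr j)//=.
  by move: qle; rewrite /e /l; lra.
(* Adding these inequalities over [j] puts the total excess on both sides; it is positive and
   cancels. *)
have Ce : kappa%:R * \sum_(0 <= i < kappa) e i <= C * \sum_(0 <= i < kappa) e i.
  set E := \sum_(0 <= i < kappa) e i in sum_e *.
  have -> : kappa%:R * E = \sum_(0 <= j < kappa) E.
    by rewrite sumr_const_nat subn0 mulr_natl.
  rewrite mulr_sumr.
  by rewrite !big_nat; apply: ler_sum => j /andP[_ jk]; exact: sum_e.
rewrite ler_pM2r// in Ce.
rewrite big_ltn// ltr_pwDl ?e_gt0//.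
by rewrite big_nat sumr_ge0// => j /andP[_ jk]; rewrite ltW// e_gt0.
Qed.

(** Of [r'.+1] walls, a block of [(hit_bound kappa r').+1] steps can miss none, since it is too long
    for [r'] walls; and [kappa] double blocks of this size are too many. *)
Fixpoint hit_bound (kappa r : nat) : nat :=
  if r is r'.+1 then (2 * (hit_bound kappa r').+1 * kappa)%N else 0%N.

(** Here [m] counts the gaps between [m.+1] hits, so the strict inequality bounds the number of hits
    by [hit_bound]. If [S] is empty, even the hit at [s 0] is impossible. *)
Lemma hits_lt (kappa : nat) : C < kappa%:R ->
  forall (S : {set K}) (m : nat) (s : nat -> R),
  (forall i, (i < m)%N -> s i < s i.+1) ->
  (forall i, (i <= m)%N -> T (s i) /\ exists k, hit (s i) k) ->
  (forall u k, s 0%N <= u <= s m -> T u -> hit u k -> k \in S) ->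
  (m < hit_bound kappa #|S|)%N.
Proof.
move=> Ck S; move: {2}#|S| (erefl #|S|) => r.
elim: r S => [|r IHr] S Sr m s sS hs hS.
  have [T0 [k hk]] := hs 0%N (leq0n m).
  have s0m : s 0%N <= s m.
    elim: m sS {hs hS} => // m IHm sS; apply: (le_trans (IHm _)).
      by move=> i im; exact: sS (leqW im).
    by rewrite ltW// sS.
  have := hS _ _ _ T0 hk; rewrite lexx s0m (cards0_eq Sr) inE => /(_ isT).
  by [].
rewrite Sr ltnNge; apply/negP => mN.
have smono i j : (i <= j <= m)%N -> s i <= s j.
  elim: j => [|j IHj]; first by rewrite leqn0 => /andP[/eqP->].
  move=> /andP[]; rewrite leq_eqVlt => /orP[/eqP->//|ij jm].
  by rewrite (le_trans (IHj _))// ?(ltW (sS _ jm))// -ltnS ij ltnW.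
have smono' i j : (i < j <= m)%N -> s i < s j.
  move=> /andP[ij jm]; rewrite (lt_le_trans (sS i _)) ?smono ?ij//.
  exact: leq_trans ij jm.
pose b := (hit_bound kappa r).+1.
(* A block that never hits [k] would only hit walls of [S :\ k], against the induction
   hypothesis. *)
have block a k : (a + b <= m)%N -> k \in S ->
    exists v, [/\ s a <= v <= s (a + b)%N, T v & hit v k].
  move=> abm kS; apply: contrapT => nohit.
  have S'r : #|S :\ k| = r by move: Sr; rewrite (cardsD1 k) kS => -[].
  suff : (b < hit_bound kappa #|S :\ k|)%N by rewrite S'r ltnNge leqnSn.
  apply: (IHr (S :\ k) S'r b (fun i => s (a + i)%N)).
  - by move=> i ib; rewrite addnS; apply: sS; lia.
  - by move=> i ib; apply: hs; lia.
  - move=> u k'; rewrite addn0 => su Tu hu; rewrite !inE (hS u k')//; last first.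
      have := smono 0%N a; have := smono (a + b)%N m; rewrite !leqnn !leq0n /= abm.
      rewrite (leq_trans (leq_addr b a) abm) => /(_ isT) h1 /(_ isT) h2.
      by move: su => /andP[s1 s2]; rewrite (le_trans h2 s1) (le_trans s2 h1).
    by rewrite andbT; apply/eqP => kk'; apply: nohit; exists u; rewrite -kk'.
have kappa0 : (0 < kappa)%N.
  by rewrite lt0n; apply/eqP => k0; move: Ck C1; rewrite k0; lra.
move: mN; rewrite /= -/b => mN.
have bj j : (j < kappa)%N ->
    (2 * b * j + b + b <= m)%N /\ (2 * b * j.+1 = 2 * b * j + b + b)%N.
  move=> jk; have : (2 * b * j.+1 <= 2 * b * kappa)%N by rewrite leq_mul2l jk orbT.
  by rewrite mulnS; lia.
suff : kappa%:R <= C by rewrite leNgt Ck.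
(* Double block [j] starts at index [2 * b * j] and has its middle at [2 * b * j + b]; neighbouring
   blocks share an end. *)
apply: (@few_double_blocks S kappa (fun j => s (2 * b * j)%N)
  (fun j => s (2 * b * j + b)%N)) => //.
- move=> j jk; apply: (hs _ _).1.
  by rewrite (leq_trans _ mN)// leq_mul2l jk orbT.
- move=> j /bj[jm ->]; split; first by apply: (hs _ _).1; lia.
  by rewrite !smono'//; lia.
- by move=> j /bj[jm _]; apply: (hs _ _).2; lia.
- move=> j k /bj[jm ->] kS; split; apply: block => //; lia.
- move=> u k; rewrite muln0 => /andP[su us]; apply: hS; rewrite su/=.
  by rewrite (le_trans us)// smono// mN leqnn.
Qed.

End Path.
End SemiDispersing.

(** * Overlaps of balls as nondegenerate convex walls *)

Lemma dot_inner_product (R : realType) : inner_product (@dot R).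
Proof.
split=> [u v|u v w|a u v|u].
- by apply: eq_bigr => k _; rewrite mulrC.
- by rewrite -big_split; apply: eq_bigr => k _; rewrite !mxE mulrDl.
- by rewrite /dot mulr_sumr; apply: eq_bigr => k _; rewrite !mxE mulrA.
- by apply: sumr_ge0 => k _; rewrite -expr2 sqr_ge0.
Qed.

Lemma ler_enormD (R : realType) (u v : 'rV[R]_3) :
  enorm (u + v) <= enorm u + enorm v.
Proof. exact: ler_ipnormD (dot_inner_product R) u v. Qed.

Lemma ler_enorm_dist (R : realType) (w u v : 'rV[R]_3) :
  enorm (u - v) <= enorm (u - w) + enorm (w - v).
Proof. exact: ler_ipnorm_dist (dot_inner_product R) w u v. Qed.

Lemma enorm_sub_sym (R : realType) (u v : 'rV[R]_3) :
  enorm (u - v) = enorm (v - u).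
Proof. exact: ipnorm_sub_sym (dot_inner_product R) u v. Qed.

Lemma enormZ (R : realType) a (u : 'rV[R]_3) : enorm (a *: u) = `|a| * enorm u.
Proof. exact: ipnormZ (dot_inner_product R) a u. Qed.

Lemma sqr_enorm (R : realType) (u : 'rV[R]_3) : enorm u ^+ 2 = dot u u.
Proof. exact: sqr_ipnorm (dot_inner_product R) u. Qed.

Section Walls.
Variables (R : realType) (n : nat).
Local Notation conf := 'M[R]_(n, 3).
Variables (rad mass : 'I_n -> R).

Definition mass_dot (A B : conf) : R :=
  \sum_i mass i * dot (row i A) (row i B).

Definition overlap (k : 'I_n * 'I_n) : set conf :=
  [set q | enorm (row k.1 q - row k.2 q) <= rad k.1 + rad k.2].

Lemma mass_dot_inner_product : (forall i, 0 < mass i) -> inner_product mass_dot.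
Proof.
move=> m0; have dP := dot_inner_product R; split=> [u v|u v w|a u v|u].
- by apply: eq_bigr => i _; rewrite (ipC dP).
- rewrite -big_split; apply: eq_bigr => i _.
  by rewrite linearD/= (ipDl dP) mulrDr.
- rewrite /mass_dot mulr_sumr; apply: eq_bigr => i _.
  by rewrite linearZ/= (ipZl dP) mulrCA.
- by apply: sumr_ge0 => i _; rewrite mulr_ge0 ?(ip_ge0 dP)// ltW.
Qed.

Lemma convex_overlap : convex_walls overlap.
Proof.
have dP := dot_inner_product R.
move=> k y z c /andP[c0 c1]; rewrite /overlap/= => yk zk.
have -> : row k.1 (chord y z c) - row k.2 (chord y z c) =
    chord (row k.1 y - row k.2 y) (row k.1 z - row k.2 z) c.
  by apply/rowP => l; rewrite !mxE; ring.
apply: (le_trans (ler_enormD _ _)); rewrite !enormZ !ger0_norm ?subr_ge0//.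
have := @ler_wpM2l _ (1 - c) _ _ _ yk; have := ler_wpM2l c0 zk.
rewrite subr_ge0 => h1 /(_ c1) h2; lra.
Qed.

Lemma enorm_path (e : rel 'I_n) (f : 'I_n -> 'rV[R]_3) M :
  (forall i j, e i j -> enorm (f i - f j) <= M) ->
  forall p i, path e i p -> enorm (f i - f (last i p)) <= (size p)%:R * M.
Proof.
move=> eM; elim=> [|j p IHp] i /=.
  by rewrite subrr mul0r /enorm /dot big1 ?sqrtr0// => k _; rewrite mxE mul0r.
move=> /andP[eij ejp].
apply: (le_trans (ler_enorm_dist (f j) _ _)).
by rewrite -natr1 mulrDl mul1r addrC lerD// ?IHp// eM.
Qed.

(** Once shortened to a simple path, a connection has fewer than [n] edges. *)
Lemma enorm_connect (e : rel 'I_n) (f : 'I_n -> 'rV[R]_3) M : 0 <= M ->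
  (forall i j, e i j -> enorm (f i - f j) <= M) ->
  forall i j, connect e i j -> enorm (f i - f j) <= n%:R * M.
Proof.
move=> M0 eM i j /connectP[p ep ->]; have [p' ep' up' _] := shortenP ep.
apply: (le_trans (enorm_path eM ep')); rewrite ler_wpM2r// ler_nat.
have := max_card (mem (i :: p')); rewrite (card_uniqP up') card_ord /=.
exact: ltnW.
Qed.

(* Shrink every connected component of the graph [S] towards one of its
   vertices. *)
Lemma nondegenerate_overlap (c1 c2 : R) :
  (forall i, 0 < rad i) -> (forall i, 0 < mass i) ->
  (forall i j, mass i <= c1 * mass j) -> (forall i j, rad i <= c2 * rad j) ->
  nondegenerate_walls mass_dot overlap (4 * n%:R ^+ 3 * c1 ^+ 2 * c2 ^+ 4 + 1).
Proof.
move=> rad0 mass0 c1P c2P S c d d0 near.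
have dP := dot_inner_product R; have mP := mass_dot_inner_product mass0.
have C0 : 0 <= 4 * n%:R ^+ 3 * c1 ^+ 2 * c2 ^+ 4.
  rewrite mulr_ge0 ?exprn_even_ge0// mulr_ge0 ?exprn_even_ge0// mulr_ge0//.
  by rewrite exprn_ge0.
have [i0 _|no] := pickP (@predT 'I_n); last first.
  exists c; first by move=> [i]; have := no i.
  by rewrite /mass_dot big1 ?mulr_ge0 ?addr_ge0 ?ler01// => i; have := no i.
set mu := mass i0; set rho := rad i0.
have mu0 : 0 < mu by exact: mass0.
have rho0 : 0 < rho by exact: rad0.
have c1_ge1 : 1 <= c1 by rewrite -(ler_pM2r mu0) mul1r c1P.
have c2_ge1 : 1 <= c2 by rewrite -(ler_pM2r rho0) mul1r c2P.
have c1_ge0 : 0 <= c1 by exact: le_trans c1_ge1.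
have c2_gt0 : 0 < c2 by exact: lt_le_trans c2_ge1.
(* A displacement of squared mass norm at most [d] moves each ball by at most [h], because each mass
   is at least [mu / c1]. *)
pose h := Num.sqrt (d * c1 / mu).
have h0 : 0 <= h by exact: sqrtr_ge0.
have h2 : h ^+ 2 * mu = d * c1.
  by rewrite sqr_sqrtr ?divfK ?gt_eqF// divr_ge0 ?mulr_ge0// ltW.
(* Lower and upper bounds for the sum of any two radii. *)
pose Rm := 2 * rho / c2; pose RM := 2 * rho * c2.
have Rm0 : 0 < Rm by rewrite divr_gt0 ?mulr_gt0.
have Rm_c2 : Rm * c2 = 2 * rho by rewrite /Rm divfK ?gt_eqF.
have Rm_le i j : Rm <= rad i + rad j.
  rewrite ler_pdivrMr//; have := c2P i0 i; have := c2P i0 j.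
  by rewrite -/rho; lra.
have RM_ge i j : rad i + rad j <= RM.
  by rewrite /RM; have := c2P i i0; have := c2P j i0; rewrite -/rho; lra.
pose f i := row i c.
have close i j : (i, j) \in S -> enorm (f i - f j) <= rad i + rad j + 2 * h.
  move=> ijS; have [y yij yd] := near _ ijS.
  have yh l : enorm (row l y - f l) <= h.
    rewrite -(@ler_pXn2r _ 2)// ?nnegrE ?sqrtr_ge0// sqr_enorm.
    rewrite -(ler_pM2r mu0) h2.
    set D := dot _ _; have D0 : 0 <= D by exact: (ip_ge0 dP).
    have mD : mass l * D <= d.
      apply: le_trans yd; rewrite /mass_dot (bigD1 l)//= linearB/= lerDl.
      apply: sumr_ge0 => i' _; rewrite mulr_ge0 ?(ip_ge0 dP)// ltW//.
    have := c1P i0 l; rewrite -/mu => /(ler_wpM2l D0) mul.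
    apply: (le_trans mul); rewrite mulrCA mulrC ler_wpM2r//.
    by rewrite mulrC.
  have t1 := ler_enorm_dist (row i y) (f i) (f j).
  have t2 := ler_enorm_dist (row j y) (row i y) (f j).
  rewrite (enorm_sub_sym (f i) (row i y)) in t1.
  have hi := yh i; have hj := yh j; rewrite /overlap/= in yij.
  lra.
pose e : rel 'I_n := [rel i j | ((i, j) \in S) || ((j, i) \in S)].
have e_sym : connect_sym e by apply: sym_connect_sym => i j; exact: orbC.
pose M := RM + 2 * h.
have RM0 : 0 <= RM by rewrite !mulr_ge0// ltW.
have M0 : 0 <= M by rewrite addr_ge0// mulr_ge0.
have eM i j : e i j -> enorm (f i - f j) <= M.
  move=> /orP[] /close ijS.
    by apply: (le_trans ijS); rewrite lerD2r.
  rewrite enorm_sub_sym.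
  by apply: (le_trans ijS); rewrite lerD2r.
(* Shrinking by [lam] absorbs the possible gap [2 * h]: [lam * (D + 2 * h) <= D] whenever
   [Rm <= D]. *)
pose lam := Rm / (Rm + 2 * h).
have den : 0 < Rm + 2 * h by rewrite ltr_wpDr ?mulr_ge0.
have lam0 : 0 <= lam by rewrite divr_ge0// ltW.
pose r := fingraph.root e.
pose q : conf := \matrix_i (f (r i) + lam *: (f i - f (r i))).
exists q.
  move=> [i j] ijS; rewrite /overlap/= !rowK.
  have -> : r j = r i.
    by apply/esym/(fingraph.rootP e_sym)/connect1; rewrite /e/= ijS.
  rewrite opprD addrACA subrr add0r -scalerBr opprB addrA subrK.
  rewrite enormZ ger0_norm//.
  apply: (le_trans (ler_wpM2l lam0 (close _ _ ijS))).
  rewrite mulrAC ler_pdivrMr//; have := Rm_le i j; nra.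
(* The displacement is at most [(1 - lam) * n%:R * M], and [M <= c2 ^+ 2 * (Rm + 2 * h)] because
   [RM = c2 ^+ 2 * Rm]; the denominator of [1 - lam] cancels. *)
have far i : enorm (f (r i) + lam *: (f i - f (r i)) - f i) <=
    2 * h * n%:R * c2 ^+ 2.
  have -> : f (r i) + lam *: (f i - f (r i)) - f i =
      (lam - 1) *: (f i - f (r i)).
    by rewrite scalerBl scale1r opprB addrCA addrA.
  rewrite enormZ.
  have -> : `|lam - 1| = 2 * h / (Rm + 2 * h).
    have -> : lam - 1 = - (2 * h / (Rm + 2 * h)).
      by rewrite /lam; field; rewrite gt_eqF.
    by rewrite normrN ger0_norm// divr_ge0 ?mulr_ge0// ltW.
  have ri := enorm_connect M0 eM (connect_root e i).
  rewrite mulrAC ler_pdivrMr// -!mulrA ler_wpM2l// ler_wpM2l//.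
  apply: (le_trans ri); rewrite ler_wpM2l// /M /RM -Rm_c2.
  have : 0 <= h * (c2 ^+ 2 - 1) by rewrite mulr_ge0// subr_ge0 expr_ge1// ltW.
  by lra.
have term i : mass i * dot (row i (q - c)) (row i (q - c)) <=
    4 * n%:R ^+ 2 * c1 ^+ 2 * c2 ^+ 4 * d.
  rewrite linearB/= rowK -sqr_enorm.
  have : enorm (f (r i) + lam *: (f i - f (r i)) - row i c) ^+ 2 <=
      (2 * h * n%:R * c2 ^+ 2) ^+ 2.
    by rewrite ler_sqr ?nnegrE ?sqrtr_ge0 ?far// !mulr_ge0// ?exprn_ge0// ltW.
  move=> /(ler_wpM2l (ltW (mass0 i))) => /le_trans; apply.
  have -> : 4 * n%:R ^+ 2 * c1 ^+ 2 * c2 ^+ 4 * d =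
    (c1 * mu) * (2 * h * n%:R * c2 ^+ 2) ^+ 2.
    transitivity (4 * n%:R ^+ 2 * c1 * c2 ^+ 4 * (d * c1)); first by ring.
    by rewrite -h2; ring.
  by rewrite ler_wpM2r ?sqr_ge0 // c1P.
(* The sum over the balls turns [n%:R ^+ 2] into [n%:R ^+ 3]. The [+ 1] makes the constant at least
   1, as [chord_detour] requires. *)
apply: (le_trans (ler_sum _ (fun i _ => term i))).
rewrite sumr_const card_ord -mulr_natr.
apply: (@le_trans _ _ (4 * n%:R ^+ 3 * c1 ^+ 2 * c2 ^+ 4 * d)).
  by rewrite le_eqVlt; apply/orP; left; apply/eqP; ring.
by rewrite ler_wpM2r//; lra.
Qed.

End Walls.

(** * Counting by lists, and monotonicity from local data *)

Lemma card_le_of_uniq (T : choiceType) (A : set T) (N : nat) :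
  (forall s : seq T, uniq s -> (forall x, x \in s -> A x) -> (size s <= N)%N) ->
  A #<= `I_N.
Proof.
move=> sN; have [finA|infA] := pselect (finite_set A); last first.
  have [B BA] := infinite_set_fset N.+1 infA.
  by rewrite leqNgt ltnS sN// => x xB; exact: BA.
have [m Am] := finA; rewrite (card_le_eql Am) card_le_II.
rewrite -(card_fset_set Am); apply: sN => // x.
by rewrite in_fset_set// inE.
Qed.

Lemma itv_between (R : realType) (I : interval R) (s t u : R) :
  s \in I -> u \in I -> s <= t <= u -> t \in I.
Proof.
case: I => l r; rewrite !itv_boundlr => /andP[ls _] /andP[_ ur] /andP[st tu].
by rewrite (le_trans ls) ?bnd_simp//= (le_trans _ ur)// bnd_simp.
Qed.

(** The supremum of the times [t] with [F a <= F t] is itself such a time by the condition on its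
    left, and equals [b] by the condition on its right. Local facts about the motion thus add up
    without an enumeration of its collisions. *)
Lemma locally_nondecreasing (R : realType) (F : R -> R) (a b : R) : a <= b ->
  (forall t, a <= t <= b -> exists2 e, 0 < e & forall s, a <= s <= b ->
     (t - e < s < t -> F s <= F t) /\ (t < s < t + e -> F t <= F s)) ->
  F a <= F b.
Proof.
move=> ab Floc; pose A := [set t | a <= t <= b /\ F a <= F t].
have Aa : A a by split=> //; rewrite lexx.
have Aub : ubound A b by move=> t [/andP[]].
have supA : has_sup A by split; [exists a|exists b].
have cle t : A t -> t <= sup A by exact: sup_upper_bound.
set c := sup A in cle.
have cb : c <= b by apply: ge_sup => //; exists a.
have ac : a <= c by exact: cle.
have [e e0 ce] := Floc c (introT andP (conj ac cb)).
have [s As cs] := sup_adherent e0 supA.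
have Fc : F a <= F c.
  have := cle s As; rewrite le_eqVlt => /orP[/eqP<-|sc]; first by case: As.
  case: As => sab Fas; apply: (le_trans Fas); apply: (ce s sab).1.
  by rewrite cs.
have [<-//|cb'] := eqVneq c b.
have {}cb : c < b by rewrite lt_neqAle cb' cb.
pose d := Num.min (e / 2) (b - c).
have d0 : 0 < d by rewrite lt_min divr_gt0// subr_gt0.
have db : d <= b - c by rewrite ge_min lexx orbT.
have de : d < e by rewrite gt_min; apply/orP; left; lra.
have abd : a <= c + d <= b by apply/andP; split; lra.
have : A (c + d).
  split=> //; apply: (le_trans Fc); apply: (ce _ abd).2.
  by apply/andP; split; lra.
by move/cle; lra.
Qed.


(** * A hard-ball motion as a billiard path *)

Definition config (R : realType) (n : nat) (f : 'I_n -> R -> 'rV[R]_3) (t : R) :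
  'M[R]_(n, 3) := \matrix_i f i t.

Lemma row_config (R : realType) (n : nat) (f : 'I_n -> R -> 'rV[R]_3) t i :
  row i (config f t) = f i t.
Proof. exact: rowK. Qed.

Section Motion.
Variables (R : realType) (n : nat) (rad mass : 'I_n -> R).
Hypotheses (rad0 : forall i, 0 < rad i) (mass0 : forall i, 0 < mass i).
Variables (I : interval R) (a : motion R n).
Hypotheses (aP : hard_ball_motion rad mass I a)
  (a2 : only_two_balls_collide rad I a).

Definition collision_pair t (k : 'I_n * 'I_n) := collisions rad I a (t, k.1, k.2).

Local Notation x := (config (pos a)).
Local Notation vin := (config (vel_in a)).
Local Notation vout := (config (vel_out a)).
Local Notation hit := collision_pair.
Let dP := dot_inner_product R.
Let mP : inner_product (mass_dot mass) := mass_dot_inner_product mass0.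
Local Notation ip := (mass_dot mass).
Local Notation "`[ u ]" := (ipnorm (mass_dot mass) u) (format "`[ u ]").

Lemma config_straight t : t \in I -> exists2 e, 0 < e & forall s, s \in I ->
  (t - e < s <= t -> x s = x t + (s - t) *: vin t) /\
  (t <= s < t + e -> x s = x t + (s - t) *: vout t).
Proof.
move=> tI; have /choice[e eP] : forall i, exists e : R, 0 < e /\
    forall s, s \in I ->
    (t - e < s <= t -> pos a i s = pos a i t + (s - t) *: vel_in a i t) /\
    (t <= s < t + e -> pos a i s = pos a i t + (s - t) *: vel_out a i t).
  by move=> i; have [e] := straight_motion aP tI i; exists e.
pose e0 := \big[Num.min/1]_i e i.
have e0e i : e0 <= e i by exact: bigmin_le.
exists e0; first by apply: lt_bigmin => // i _; exact: (eP i).1.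
move=> s sI; split=> st; apply/row_matrixP => i;
  rewrite linearD/= linearZ/= !row_config; have [left right] := (eP i).2 s sI.
- by apply: left; move: st (e0e i); lra.
- by apply: right; move: st (e0e i); lra.
Qed.

Lemma vout_unique s u v : s \in I -> u \in I -> s < u ->
  (forall r, s < r < u -> x r = x s + (r - s) *: v) -> vout s = v.
Proof.
move=> sI uI su xv; have [e e0 eP] := config_straight sI.
pose d := Num.min (e / 2) ((u - s) / 2).
have d0 : 0 < d by rewrite lt_min !divr_gt0// subr_gt0.
have de : d < e by rewrite gt_min; apply/orP; left; lra.
have du : d < u - s by rewrite gt_min; apply/orP; right; lra.
have rI : s + d \in I by apply: (itv_between sI uI); apply/andP; split; lra.
have := (eP _ rI).2; rewrite xv; last by apply/andP; split; lra.
have -> : s + d - s = d by rewrite addrAC subrr add0r.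
move=> h; have /addrI/esym/scalerI-> // : x s + d *: v = x s + d *: vout s.
  by apply: h; apply/andP; split; lra.
by rewrite gt_eqF.
Qed.

Lemma config_flight t : t \in I -> exists2 e, 0 < e & forall s, s \in I ->
  (t - e < s < t -> x s = x t + (s - t) *: vin t /\ vout s = vin t) /\
  (t < s < t + e -> x s = x t + (s - t) *: vout t /\ vout s = vout t).
Proof.
move=> tI; have [e e0 eP] := config_straight tI.
(* To apply [vout_unique] after [t], a later time in [I] is needed: [d] is cut so that [t + d] lies
   in [I] unless [t] is the last time. *)
have [d [d0 de dI]] : exists d, [/\ 0 < d, d <= e &
    forall s, s \in I -> t < s < t + d -> t + d \in I].
  have [[u [uI tu]]|no] := pselect (exists u, u \in I /\ t < u).
    exists (Num.min e (u - t)); split.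
    - by rewrite lt_min e0 subr_gt0.
    - by rewrite ge_min lexx.
    - move=> s sI /andP[ts _]; apply: (itv_between tI uI).
      rewrite lerDl le_min (ltW e0) subr_ge0 (ltW tu)/=.
      by rewrite -lerBrDl ge_min lexx orbT.
  exists e; split=> // s sI /andP[ts _]; exfalso; apply: no; by exists s.
exists d => // s sI; split=> st.
  have xs : x s = x t + (s - t) *: vin t by apply: (eP s sI).1; move: st; lra.
  split=> //; apply: (vout_unique sI tI) => [|r srt]; first by case/andP: st.
  have rI : r \in I by apply: (itv_between sI tI); move: srt; lra.
  rewrite (eP r rI).1 ?xs; last by move: srt st; lra.
  by rewrite -addrA -scalerDl; congr (_ + _ *: _); ring.
have xs : x s = x t + (s - t) *: vout t by apply: (eP s sI).2; move: st; lra.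
have tdI := dI s sI st.
split=> //; apply: (vout_unique sI tdI) => [|r srt]; first by case/andP: st.
have rI : r \in I by apply: (itv_between sI tdI); move: srt; lra.
rewrite (eP r rI).2 ?xs; last by move: srt st; lra.
by rewrite -addrA -scalerDl; congr (_ + _ *: _); ring.
Qed.

Lemma colliding_sym t i j : colliding rad a t i j -> colliding rad a t j i.
Proof.
move=> [ij dij vij]; split; first by rewrite eq_sym.
  by rewrite enorm_sub_sym [RHS]addrC.
rewrite -(opprB (pos a i t)) -(opprB (vel_in a i t)).
by rewrite (ipNl dP) (ipNr dP) opprK.
Qed.

Lemma colliding_hit t i j : t \in I -> colliding rad a t i j ->
  exists k, hit t k /\ (k = (i, j) \/ k = (j, i)).
Proof.
move=> tI cij; have [ij _ _] := cij.
case: (ltngtP i j) => [lt|lt|/val_inj eq_ij]; last by rewrite eq_ij eqxx in ij.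
  by exists (i, j); split; [split|left].
by exists (j, i); split; [split=> //; exact: colliding_sym|right].
Qed.

Lemma no_hit_vout t : t \in I -> (forall k, ~ hit t k) -> vout t = vin t.
Proof.
move=> tI no; apply/row_matrixP => i; rewrite !row_config.
apply: (free_flight aP tI) => j /(colliding_hit tI)[k [hk _]]; exact: no hk.
Qed.

(* The two balls exchange the momentum [b *: (pos a k.1 t - pos a k.2 t)]. *)
Lemma hit_impulse t k : hit t k -> exists2 b : R, 0 < b & forall z,
  ip z (vout t - vin t) =
  b * dot (row k.1 z - row k.2 z) (pos a k.1 t - pos a k.2 t).
Proof.
case: k => i j [/= tI ltij cij]; have [ij dij vij] := cij.
have [o1 o2 mom _ refl] := collision_law aP tI cij.
set w := pos a i t - pos a j t in dij vij o1 o2 refl *.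
have ww : dot w w != 0.
  apply/eqP => ww; have := addr_gt0 (rad0 i) (rad0 j).
  by rewrite -dij /enorm ww sqrtr0 ltxx.
have along u u' : proj_orth w u' = proj_orth w u ->
    u' - u = (dot (u' - u) w / dot w w) *: w.
  rewrite /proj_orth => h; rewrite (ipDl dP) (ipNl dP) mulrBl scalerBl.
  apply/eqP; rewrite subr_eq -{1}(subrK (proj_along w u') u') h.
  by rewrite [X in X == _]addrC (addrC u) addrA.
have [p Di] : exists p, vel_out a i t - vel_in a i t = p *: w.
  by rewrite (along _ _ o1); eexists.
have [q Dj] : exists q, vel_out a j t - vel_in a j t = q *: w.
  by rewrite (along _ _ o2); eexists.
have mpq : mass i * p + mass j * q = 0.
  have : (mass i * p + mass j * q) *: w = 0.
    rewrite scalerDl -(scalerA (mass i)) -(scalerA (mass j)) -Di -Dj !scalerBr.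
    by rewrite addrACA -opprD mom subrr.
  move/eqP; rewrite scaler_eq0 => /orP[/eqP//|/eqP w0].
  by move: ww; rewrite w0 /dot big1 ?eqxx// => k _; rewrite mxE mul0r.
(* The balls approach each other, and the collision reverses their relative velocity along [w]. *)
have pq : 0 < p - q.
  have : (p - q) * dot w w = - 2 * dot (vel_in a i t - vel_in a j t) w.
    rewrite mulrBl -!(ipZl dP _ w) -Di -Dj; move: refl.
    rewrite !(ipDl dP) !(ipNl dP); lra.
  have w_gt0 : 0 < dot w w by rewrite lt_neqAle eq_sym ww (ip_ge0 dP).
  rewrite -(pmulr_lgt0 _ w_gt0) => ->; have := vij.
  by rewrite (ipC dP); lra.
(* If [p <= 0], then [q < p] is negative too, against the momentum balance [mpq]. *)
exists (mass i * p).
  rewrite ltNge; apply/negP => p0.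
  have p_le0 : p <= 0 by rewrite -(pmulr_rle0 _ (mass0 i)).
  have : mass j * q < 0 by rewrite pmulr_rlt0//; lra.
  by lra.
move=> z; rewrite /mass_dot (bigD1 i)//= (bigD1 j)/=; last by rewrite eq_sym.
rewrite big1 => [|l /andP[li lj]].
  rewrite addr0 !linearB/= !row_config Di Dj !(ipZr dP).
  rewrite !mulrA (ipDl dP) (ipNl dP).
  have -> : mass j * q = - (mass i * p).
    by apply/eqP; rewrite -addr_eq0 addrC mpq.
  by ring.
rewrite linearB/= !row_config (free_flight aP tI) ?subrr.
  by rewrite /dot big1 ?mulr0// => m _; rewrite !mxE mulr0.
(* A collision of a third ball [l] at time [t] would be a second colliding pair. *)
move=> m /(colliding_hit tI)[[k1 k2] [hk klm]].
have [k1i k2j] := a2 hk (And3 tI ltij cij); move: klm; rewrite k1i k2j.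
by case=> -[lE mE]; [rewrite lE eqxx in li|rewrite mE eqxx in lj].
Qed.

Lemma hit_reflect t k : hit t k ->
  dot (vel_out a k.1 t - vel_out a k.2 t) (pos a k.1 t - pos a k.2 t) =
    - dot (vel_in a k.1 t - vel_in a k.2 t) (pos a k.1 t - pos a k.2 t) /\
  dot (vel_in a k.1 t - vel_in a k.2 t) (pos a k.1 t - pos a k.2 t) < 0.
Proof.
case: k => i j [/= tI _ cij]; have [_ _ _ _ refl] := collision_law aP tI cij.
by split=> //; case: cij => _ _; rewrite (ipC dP).
Qed.

Lemma row_diffD (A B : 'M[R]_(n, 3)) i j :
  row i (A + B) - row j (A + B) = (row i A - row j A) + (row i B - row j B).
Proof. by apply/rowP => l; rewrite !mxE; ring. Qed.

Lemma row_diffB (A B : 'M[R]_(n, 3)) i j :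
  row i (A - B) - row j (A - B) = (row i A - row j A) - (row i B - row j B).
Proof. by apply/rowP => l; rewrite !mxE; ring. Qed.

(** The impulse acts along the line of centers, where the relative velocity changes sign, so
    [vout t + vin t] is orthogonal to [vout t - vin t]. *)
Lemma energy_in_out t : t \in I -> ip (vout t) (vout t) = ip (vin t) (vin t).
Proof.
move=> tI; have [[k hk]|no] := pselect (exists k, hit t k); last first.
  by rewrite no_hit_vout// => k hk; apply: no; exists k.
have [b b0 bP] := hit_impulse hk; have [refl _] := hit_reflect hk.
have : ip (vout t + vin t) (vout t - vin t) = 0.
  by rewrite bP row_diffD !row_config (ipDl dP) refl addNr mulr0.
rewrite (ipDl mP) !(ipDr mP) !(ipNr mP) (ipC mP (vin t) (vout t)); lra.
Qed.

Lemma hit_bend t k : hit t k -> 0 < ip (vout t - vin t) (vout t - vin t).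
Proof.
move=> hk; have [b b0 bP] := hit_impulse hk; have [refl neg] := hit_reflect hk.
rewrite bP row_diffB !row_config (ipDl dP) (ipNl dP) refl mulr_gt0//; lra.
Qed.

(** At contact the distance of the centers equals the sum of the radii, which bounds that distance
    in any overlapping [q]. By Cauchy-Schwarz the impulse then points away from [q]. *)
Lemma hit_outward t q : t \in I -> (forall k, hit t k -> overlap rad k q) ->
  0 <= ip (x t - q) (vout t - vin t).
Proof.
move=> tI qB; have [[k hk]|no] := pselect (exists k, hit t k); last first.
  have -> : vout t = vin t by apply: no_hit_vout => // k hk; apply: no; exists k.
  by rewrite (ipDr mP) (ipNr mP) subrr.
have [b b0 bP] := hit_impulse hk; rewrite bP; apply: mulr_ge0; first exact: ltW.
have := qB k hk; rewrite /overlap/= row_diffB !row_config.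
case: hk => [/= _ _ [_ <- _]].
set w := pos a k.1 t - pos a k.2 t; set v := row _ q - row _ q => vw.
rewrite (ipDl dP) (ipNl dP) subr_ge0 -sqr_enorm expr2.
apply: (le_trans (cauchy_schwarz dP _ _)).
by rewrite ler_wpM2r// sqrtr_ge0.
Qed.

Lemma energy_constant s t : s \in I -> t \in I -> s <= t ->
  ip (vout s) (vout s) = ip (vout t) (vout t).
Proof.
move=> sI tI st.
have loc r : s <= r <= t -> exists2 e, 0 < e & forall r', s <= r' <= t ->
    (r - e < r' < r -> ip (vout r') (vout r') = ip (vout r) (vout r)) /\
    (r < r' < r + e -> ip (vout r') (vout r') = ip (vout r) (vout r)).
  move=> srt; have rI := itv_between sI tI srt.
  have [e e0 eP] := config_flight rI; exists e => // r' /(itv_between sI tI) r'I.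
  have [left right] := eP r' r'I.
  by split=> [/left[_ ->]|/right[_ ->]//]; rewrite energy_in_out.
apply/eqP; rewrite eq_le; apply/andP; split.
  apply: (@locally_nondecreasing _ (fun r => ip (vout r) (vout r))) => // r.
  move=> /loc[e e0 eP]; exists e => // r' /eP[left right].
  by split=> [/left->|/right->].
rewrite -lerN2.
apply: (@locally_nondecreasing _ (fun r => - ip (vout r) (vout r))) => // r.
move=> /loc[e e0 eP]; exists e => // r' /eP[left right].
by split=> [/left->|/right->].
Qed.

Section Speed.
Variable w : R.
Hypothesis vw : forall t, t \in I -> `[vout t] = w.

Lemma vin_speed t : t \in I -> `[vin t] = w.
Proof. by move=> tI; rewrite -(vw tI) /ipnorm energy_in_out. Qed.

(** The projection of the path on its total displacement [u] grows at a rate of at most [w] times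
    the norm of [u]. *)
Lemma config_lipschitz s t : s \in I -> t \in I -> s <= t ->
  `[x t - x s] <= w * (t - s).
Proof.
move=> sI tI st; set u := x t - x s.
have w0 : 0 <= w by rewrite -(vw sI) ipnorm_ge0.
have [->|u0] := eqVneq `[u] 0; first by rewrite mulr_ge0// subr_ge0.
have {}u0 : 0 < `[u] by rewrite lt_neqAle eq_sym u0 ipnorm_ge0.
rewrite -(ler_pM2r u0) -expr2 (sqr_ipnorm mP).
have h : w * `[u] * s - ip (x s) u <= w * `[u] * t - ip (x t) u.
  apply: (@locally_nondecreasing _ (fun r => w * `[u] * r - ip (x r) u)) => // r.
  move=> /(itv_between sI tI) rI; have [e e0 eP] := config_flight rI.
  exists e => // r' /(itv_between sI tI) r'I; have [left right] := eP r' r'I.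
  split=> rr'.
    rewrite (left rr').1 (ipDl mP) (ipZl mP).
    have := cauchy_schwarz mP (vin r) u; rewrite vin_speed//.
    have : 0 < r - r' by move: rr'; lra.
    by nra.
  rewrite (right rr').1 (ipDl mP) (ipZl mP).
  have := cauchy_schwarz mP (vout r) u; rewrite vw//.
  have : 0 < r' - r by move: rr'; lra.
  by nra.
by rewrite {1}/u (ipDl mP) (ipNl mP); lra.
Qed.

(** The velocities before and after the hit have equal norm [w] but differ, so by the parallelogram
    law their sum is shorter than [2 * w]; a short chord across the hit is thus strictly shorter
    than the path. *)
Lemma config_bends s t u k : s \in I -> u \in I -> s < t < u -> hit t k ->
  `[x u - x s] < w * (u - s).
Proof.
move=> sI uI /andP[st tu] hk.
have tI : t \in I by case: hk.
have [e e0 eP] := config_flight tI.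
pose d := Num.min (e / 2) (Num.min (t - s) (u - t)).
have d0 : 0 < d by rewrite !lt_min divr_gt0// !subr_gt0 st tu.
have de : d < e by rewrite gt_min; apply/orP; left; lra.
have ds : d <= t - s by rewrite !ge_min lexx orbT.
have du : d <= u - t by rewrite !ge_min lexx !orbT.
have t1I : t - d \in I by apply: (itv_between sI uI); lra.
have t2I : t + d \in I by apply: (itv_between sI uI); lra.
have w0 : 0 <= w by rewrite -(vw sI) ipnorm_ge0.
have mid : `[x (t + d) - x (t - d)] < w * (2 * d).
  have h2 : t < t + d < t + e by lra.
  have h1 : t - e < t - d < t by lra.
  rewrite ((eP _ t2I).2 h2).1 ((eP _ t1I).1 h1).1.
  have -> : x t + (t + d - t) *: vout t - (x t + (t - d - t) *: vin t) =
      d *: (vout t + vin t).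
    by apply/matrixP => i j; rewrite !mxE; ring.
  rewrite (ipnormZ mP) gtr0_norm// mulrCA mulrA (mulrC d) ltr_pM2r//.
  rewrite -(@ltr_pXn2r _ 2)// ?nnegrE ?ipnorm_ge0 ?mulr_ge0// (sqr_ipnorm mP).
  have := hit_bend hk; rewrite !(ipE mP) (ipC mP (vin t) (vout t)).
  by rewrite -!(sqr_ipnorm mP) vw// vin_speed//; lra.
have := ler_ipnorm_dist mP (x (t + d)) (x u) (x s).
have := ler_ipnorm_dist mP (x (t - d)) (x (t + d)) (x s).
have h1 : `[x u - x (t + d)] <= w * (u - (t + d)).
  by apply: config_lipschitz => //; lra.
have h2 : `[x (t - d) - x s] <= w * (t - d - s).
  by apply: config_lipschitz => //; lra.
by lra.
Qed.

(* Between collisions [<x - q, v>] grows at the rate [w^2], and at a collision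
   it does not decrease. *)
Lemma config_detour s t q : s \in I -> t \in I -> s <= t ->
  (forall u k, s <= u <= t -> hit u k -> overlap rad k q) ->
  w * (t - s) <= `[x s - q] + `[q - x t].
Proof.
move=> sI tI st qB.
have w0 : 0 <= w by rewrite -(vw sI) ipnorm_ge0.
have [->|w_n0] := eqVneq w 0; first by rewrite mul0r addr_ge0 ?ipnorm_ge0.
have w_gt0 : 0 < w by rewrite lt_neqAle eq_sym w_n0.
have h : ip (x s - q) (vout s) - w ^+ 2 * s <= ip (x t - q) (vout t) - w ^+ 2 * t.
  apply: (@locally_nondecreasing _
    (fun r => ip (x r - q) (vout r) - w ^+ 2 * r)) => // r srt.
  have rI := itv_between sI tI srt; have [e e0 eP] := config_flight rI.
  exists e => // r' /(itv_between sI tI) r'I; have [left right] := eP r' r'I.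
  split=> rr'.
    have [-> ->] := left rr'; have := hit_outward rI (fun k => qB r k srt).
    rewrite addrAC (ipDr mP) (ipNr mP) (ipDl mP _ ((r' - r) *: _)) (ipZl mP).
    by rewrite -(sqr_ipnorm mP (vin r)) vin_speed//; lra.
  have [-> ->] := right rr'.
  rewrite addrAC (ipDl mP _ ((r' - r) *: _)) (ipZl mP).
  by rewrite -(sqr_ipnorm mP (vout r)) vw//; lra.
(* Cauchy-Schwarz bounds the monotone quantity at both ends by [w] times the distance to [q], and
   one factor [w] is divided out. *)
have h1 := cauchy_schwarz mP (x t - q) (vout t).
have h2 := cauchy_schwarz mP (q - x s) (vout s).
rewrite -(ler_pM2r w_gt0) (ipnorm_sub_sym mP (x s) q).
rewrite (ipnorm_sub_sym mP q (x t)).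
rewrite vw// in h1; rewrite vw// -(opprB (x s)) (ipNl mP) (ipnormN mP) in h2.
by rewrite (ipnorm_sub_sym mP q (x s)); lra.
Qed.

End Speed.

Lemma collisions_le c1 c2 kappa :
  (forall i j, mass i <= c1 * mass j) -> (forall i j, rad i <= c2 * rad j) ->
  4 * n%:R ^+ 3 * c1 ^+ 2 * c2 ^+ 4 + 1 < kappa%:R :> R ->
  collisions rad I a #<= `I_(hit_bound kappa #|{: 'I_n * 'I_n}|).
Proof.
move=> c1P c2P Ck; apply: card_le_of_uniq => -[//|c0 l] ul lP.
(* Only one pair collides at a time, so the collision times are distinct and this list is strictly
   increasing. *)
set times := sort <=%O [seq c.1.1 | c <- c0 :: l].
have size_times : size times = (size l).+1 by rewrite size_sort size_map.
have t_uniq : uniq times.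
  rewrite sort_uniq map_inj_in_uniq// => -[[t i] j] [[t' i'] j'] /lP h /lP h' /= tt'.
  by move: h h'; rewrite /= -tt' => h h'; have [-> ->] := a2 h h'.
have t_lt i : (i < size l)%N -> nth 0 times i < nth 0 times i.+1.
  move=> il; have /(sortedP 0) : sorted <%O times.
    by rewrite lt_sorted_uniq_le t_uniq sort_le_sorted.
  by apply; rewrite size_times ltnS.
have t_hit i : (i <= size l)%N ->
    nth 0 times i \in I /\ exists k, hit (nth 0 times i) k.
  move=> il; have : nth 0 times i \in times by rewrite mem_nth// size_times ltnS.
  rewrite mem_sort => /mapP[[[t i'] j] /lP hc ->].
  by split; [case: hc|exists (i', j)].
have [c0I _ _] := lP _ (mem_head c0 l).
set w := `[vout c0.1.1].
have vw t : t \in I -> `[vout t] = w.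
  move=> tI; rewrite /w /ipnorm; case/orP: (le_total t c0.1.1) => ?.
    by rewrite (@energy_constant t c0.1.1).
  by rewrite (@energy_constant c0.1.1 t).
have xP : billiard_path (mass_dot mass) (overlap rad) [set` I] x w hit.
  split=> [t k _ [_ _ [_ d_eq _]]|s t||s t q].
  - by rewrite /overlap/= !row_config d_eq.
  - exact: config_lipschitz.
  - by move=> s t u k sI uI stu _; exact: config_bends.
  - move=> sI tI st qB; apply: config_detour => // u k stu; apply: qB => //.
    exact: (itv_between sI tI).
rewrite -cardsT.
(* The [(size l).+1] collisions leave [size l] gaps. *)
apply: (hits_lt mP (@convex_overlap _ _ rad)
  (nondegenerate_overlap rad0 mass0 c1P c2P) _ xP Ck t_lt t_hit) => //.
rewrite lerDr mulr_ge0 ?exprn_even_ge0// mulr_ge0 ?exprn_even_ge0//.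
by rewrite mulr_ge0// exprn_ge0.
Qed.

End Motion.

(** * Bounds in terms of the ratios of masses and radii *)

Lemma collisions_uniform_bound (R : realType) (n : nat) (c1 c2 : R) :
  exists N : nat, forall rad mass : 'I_n -> R,
  (forall i, 0 < rad i) -> (forall i, 0 < mass i) ->
  (forall i j, mass i <= c1 * mass j) -> (forall i j, rad i <= c2 * rad j) ->
  forall (I : interval R) (a : motion R n),
  hard_ball_motion rad mass I a -> only_two_balls_collide rad I a ->
  collisions rad I a #<= `I_N.
Proof.
set C := 4 * n%:R ^+ 3 * c1 ^+ 2 * c2 ^+ 4 + 1 : R.
(* The integer [kappa] exceeds a constant made of [n], [c1] and [c2] only, so one [N] serves all
   radii and masses within these ratios. *)
exists (hit_bound (Num.bound `|C|) #|{: 'I_n * 'I_n}|).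
move=> rad mass r0 m0 mc rc I a aP a2.
apply: (collisions_le r0 m0 aP a2 mc rc); 
apply: (le_lt_trans (ler_norm C)).
exact: archi_boundP.
Qed.

Lemma ratio_bounded (R : realType) (n : nat) (f : 'I_n -> R) :
  (forall i, 0 < f i) -> exists c, forall i j, f i <= c * f j.
Proof.
move=> f0; exists (\sum_i \sum_j f i / f j) => i j; rewrite -ler_pdivrMr//.
have pos i' j' : 0 <= f i' / f j' by rewrite divr_ge0// ltW.
rewrite (bigD1 i)//= (bigD1 j)//= -addrA lerDl addr_ge0 ?sumr_ge0//.
by move=> i' _; rewrite sumr_ge0.
Qed.

Theorem corollary3p12 (R : realType) (n : nat) :
  (forall rad mass : 'I_n -> R,
     (forall i, 0 < rad i) -> (forall i, 0 < mass i) ->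
     exists N : nat, forall (I : interval R) (a : motion R n),
       hard_ball_motion rad mass I a -> only_two_balls_collide rad I a ->
       collisions rad I a #<= `I_N) /\
  (exists N : nat, forall rho mu : R, 0 < rho -> 0 < mu ->
     forall (I : interval R) (a : motion R n),
       hard_ball_motion (fun=> rho) (fun=> mu) I a ->
       only_two_balls_collide (fun=> rho) I a ->
       collisions (fun=> rho) I a #<= `I_N).
Proof.
split=> [rad mass rad0 mass0|].
  have [c1 mc] := ratio_bounded mass0; have [c2 rc] := ratio_bounded rad0.
  have [N NP] := collisions_uniform_bound n c1 c2.
  by exists N => I a; apply: NP.
(* For identical balls both ratios are 1, whatever [rho] and [mu]. *)
have [N NP] := collisions_uniform_bound n (1 : R) 1.
by exists N => rho mu rho0 mu0 I a; apply: NP => // *; rewrite mul1r.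
Qed.
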